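(* Let $(S,R)$ be a monoid presentation such that: (i) there exists an $\equiv_R$-invariant map $\lambda$ from $S^*$ to the ordinals satisfying $\lambda(sw)>\lambda(w)$ for all $s\in S$ and $w\in S^*$ (where $\equiv_R$-invariant means that $w\equiv_R w'$ implies $\lambda(w)=\lambda(w')$); (ii) for every $s\in S$ and every relation $w=w'$ in $R$: for every $(S,R)$-grid from $(s,w)$ there exists an equivalent $(S,R)$-grid from $(s,w')$, and, vice versa, for every $(S,R)$-grid from $(s,w')$ there exists an equivalent $(S,R)$-grid from $(s,w)$; (iii) there is no relation $sw=sw'$ in $R$ with $s\in S$ and $w,w'$ distinct words of $S^*$. Then the monoid $\langle S\mid R\rangle^+$ is left cancellative.
   Context: Words and presentations. $S$ is a nonempty set, $S^*$ is the free monoid of all words in $S$, and $\varepsilon$ is the empty word. A monoid presentation is a pair $(S,R)$, where $R$ is a family of unordered pairs $\{w,w'\}$ of words of $S^*$, written as relations $w=w'$. $\equiv_R$ is the congruence on $S^*$ generated by $R$, and $\langle S\mid R\rangle^+ := S^*/{\equiv_R}$. Grids. An $(S,R)$-grid is a rectangular diagram consisting of finitely many matching elementary rectangular pieces (tiles). In each piece the vertical edges are oriented downwards and the horizontal edges are oriented to the right; the left and top edges carry one label of $S\cup\{\varepsilon\}$ each, and the right and bottom edges carry one label or a sequence of labels. The allowed pieces are: - left $s$, top $t$, right $s_1,\dots,s_p$ (read downwards), bottom $t_1,\dots,t_q$ (read left to right), where $s,t,s_i,t_j\in S$ and $s t_1\cdots t_q = t s_1\cdots s_p$ is a relation of $R$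 (an edge with $p=0$ or $q=0$ letters is labeled $\varepsilon$); - left $s$, top $s$, right $\varepsilon$, bottom $\varepsilon$, with $s\in S$; - left $s$, top $\varepsilon$, right $s$, bottom $\varepsilon$, with $s\in S$; - left $\varepsilon$, top $t$, right $\varepsilon$, bottom $t$, with $t\in S$; - all four edges labeled $\varepsilon$. Adjacent pieces match when the labels on the common part of their edges coincide (a bottom or right edge carrying several letters is subdivided accordingly, each of its letters being the top or left edge of a further piece). For $u,v,u_1,v_1\in S^*$, a grid goes from $(u,v)$ (its source) to $(u_1,v_1)$ (its target) if the labels of its left and top sides form the words $u$ and $v$, and the labels of its right and bottom sides form the words $u_1$ and $v_1$, respectively (labels $\varepsilon$ being disregarded). Two $(S,R)$-grids $\Gamma,\Gamma'$ are equivalent if the words formed by the labels of the four sides (left, top, right, bottom) of $\Gamma$ are $\equiv_R$-equivalent to the words formed by the corresponding sides of $\Gamma'$. *)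

(* Defs.v *)
From HB Require Import structures.
From mathcomp Require Import all_boot.
From mathcomp Require Import generic_quotient boolp.
From Stdlib Require Import Inverse_Image.

Set Implicit Arguments.
Unset Strict Implicit.
Unset Printing Implicit Defensive.

(* A family of unordered pairs of words is given by an arbitrary binary         *)
(* predicate R on words, where R w w' and R w' w denote the same pair {w, w'};  *)
(* R is therefore only used through is_relation, its symmetrization.            *)
Definition presentation (S : Type) : Type := seq S -> seq S -> Prop.

Definition is_relation (S : Type) (R : presentation S) (w w' : seq S) : Prop :=
  R w w' \/ R w' w.

Inductive pres_congr (S : Type) (R : presentation S) :
    seq S -> seq S -> Prop :=
| pres_congr_rel w w' : is_relation R w w' -> pres_congr R w w'
| pres_congr_refl w : pres_congr R w w
| pres_congr_sym w w' : pres_congr R w w' -> pres_congr R w' w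
| pres_congr_trans w1 w2 w3 :
    pres_congr R w1 w2 -> pres_congr R w2 w3 -> pres_congr R w1 w3
| pres_congr_cat u u' v v' :
    pres_congr R u u' -> pres_congr R v v' -> pres_congr R (u ++ v) (u' ++ v').

Section PresentedMonoid.
Variables (S : choiceType) (R : presentation S).

Definition pres_congrb : rel (seq S) := fun w w' => `[< pres_congr R w w' >].

Lemma pres_congrb_refl : reflexive pres_congrb.
Proof. by move=> w; apply/asboolP; exact: pres_congr_refl. Qed.

Lemma pres_congrb_sym : symmetric pres_congrb.
Proof.
by move=> w w'; apply/asboolP/asboolP => h; exact: pres_congr_sym.
Qed.

Lemma pres_congrb_trans : transitive pres_congrb.
Proof.
move=> w2 w1 w3 /asboolP h12 /asboolP h23; apply/asboolP.
exact: pres_congr_trans h12 h23.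
Qed.

Canonical pres_congr_equiv :=
  EquivRel pres_congrb pres_congrb_refl pres_congrb_sym pres_congrb_trans.

Definition presented_monoid : Type := {eq_quot pres_congr_equiv}%qT.

HB.instance Definition _ := Choice.on presented_monoid.
HB.instance Definition _ := EqQuotient.on presented_monoid.

Definition word_class (w : seq S) : presented_monoid :=
  \pi_presented_monoid%qT w.

Lemma word_classP (w w' : seq S) :
  word_class w = word_class w' <-> pres_congr R w w'.
Proof.
split; first by move/eqquotP/asboolP.
by move=> h; apply/eqquotP/asboolP.
Qed.

Definition pm_one : presented_monoid := word_class [::].

Definition pm_mul (x y : presented_monoid) : presented_monoid :=
  word_class (repr x ++ repr y).

Lemma pm_mulE (u v : seq S) :
  pm_mul (word_class u) (word_class v) = word_class (u ++ v).
Proof.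
apply/word_classP; apply: pres_congr_cat; apply/word_classP; exact: reprK.
Qed.

Lemma pm_mulA : associative pm_mul.
Proof.
move=> x y z; rewrite -[x]reprK -[y]reprK -[z]reprK.
by rewrite -!/(word_class _) !pm_mulE catA.
Qed.

Lemma pm_mul1 : left_id pm_one pm_mul.
Proof. by move=> x; rewrite -[x]reprK -!/(word_class _) pm_mulE. Qed.

Lemma pm_mulr1 : right_id pm_one pm_mul.
Proof. by move=> x; rewrite -[x]reprK -!/(word_class _) pm_mulE cats0. Qed.

HB.instance Definition _ :=
  isMonoid.Build presented_monoid pm_mulA pm_mul1 pm_mulr1.

End PresentedMonoid.

Definition left_cancellative (M : monoidType) : Prop :=
  forall x y z : M, (x * y = x * z)%g -> y = z.

(* None stands for the label epsilon. *)
Definition label (S : Type) : Type := option S.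

Definition label_word (S : Type) (l : seq (label S)) : seq S := pmap id l.

(* The subdivision of the right or bottom side of a piece carrying the letters  *)
(* of w: one edge per letter, but a single epsilon edge if w is empty.          *)
Definition piece_side (S : Type) (w : seq S) : seq (label S) :=
  if w is [::] then [:: None] else map some w.

(* Arguments: label of the left edge, label of the top edge, labels of the      *)
(* right side (read downwards), labels of the bottom side (left to right).      *)
Inductive piece (S : Type) (R : presentation S) :
    label S -> label S -> seq (label S) -> seq (label S) -> Type :=
| piece_relation (s t : S) (ss ts : seq S) :
    is_relation R (s :: ts) (t :: ss) ->
    piece R (Some s) (Some t) (piece_side ss) (piece_side ts)
| piece_same (s : S) : piece R (Some s) (Some s) [:: None] [:: None]
| piece_left (s : S) : piece R (Some s) None [:: Some s] [:: None]
| piece_top (t : S) : piece R None (Some t) [:: None] [:: Some t]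
| piece_eps : piece R None None [:: None] [:: None].

(* Rectangular diagrams with the labels of their left, top, right and bottom    *)
(* sides. Since the left and top sides of a piece are single edges, the lower   *)
(* side of a piece is always prolonged to the right, and its right side         *)
(* downwards, up to the boundary of the diagram. Hence a diagram of more than   *)
(* one piece is cut in two by a full line, that is, all diagrams are obtained   *)
(* from pieces by gluing two diagrams along a full side with the same labels.   *)
Inductive diagram (S : Type) (R : presentation S) :
    seq (label S) -> seq (label S) -> seq (label S) -> seq (label S) -> Type :=
| diagram_piece l t r b : piece R l t r b -> diagram R [:: l] [:: t] r b
| diagram_beside l t t' m r b b' :
    diagram R l t m b -> diagram R m t' r b' ->
    diagram R l (t ++ t') r (b ++ b')
| diagram_above l l' t m r r' b :
    diagram R l t r m -> diagram R l' m r' b ->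
    diagram R (l ++ l') t (r ++ r') b.

Record grid (S : Type) (R : presentation S) : Type := Grid {
  left_labels : seq (label S);
  top_labels : seq (label S);
  right_labels : seq (label S);
  bottom_labels : seq (label S);
  grid_diagram :
    diagram R left_labels top_labels right_labels bottom_labels
}.

Section Grids.
Variables (S : Type) (R : presentation S).
Implicit Types G H : grid R.

Definition left_word G : seq S := label_word (left_labels G).
Definition top_word G : seq S := label_word (top_labels G).
Definition right_word G : seq S := label_word (right_labels G).
Definition bottom_word G : seq S := label_word (bottom_labels G).

Definition grid_from G (u v : seq S) : Prop :=
  left_word G = u /\ top_word G = v.

Definition grid_equiv G H : Prop :=
  [/\ pres_congr R (left_word G) (left_word H),
      pres_congr R (top_word G) (top_word H),
      pres_congr R (right_word G) (right_word H)
    & pres_congr R (bottom_word G) (bottom_word H)].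

End Grids.

(* Ordinals are represented by well-ordered types: equality of ordinals is      *)
(* order isomorphism, and a < b means that a is the order type of a proper      *)
(* initial segment of b.                                                        *)
Record ordinal_number : Type := OrdinalNumber {
  on_sort :> Type;
  on_rel : on_sort -> on_sort -> Prop;
  on_trans : forall x y z, on_rel x y -> on_rel y z -> on_rel x z;
  on_total : forall x y, [\/ on_rel x y, x = y | on_rel y x];
  on_wf : well_founded on_rel
}.

Definition on_eq (a b : ordinal_number) : Prop :=
  exists f : a -> b,
    bijective f /\ forall x y, on_rel x y <-> on_rel (f x) (f y).

Definition segment (a : ordinal_number) (z : a) : Type := {x : a | on_rel x z}.

Lemma segment_trans (a : ordinal_number) (z : a) (x y w : segment z) :
  on_rel (sval x) (sval y) -> on_rel (sval y) (sval w) ->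
  on_rel (sval x) (sval w).
Proof. exact: on_trans. Qed.

Lemma segment_total (a : ordinal_number) (z : a) (x y : segment z) :
  [\/ on_rel (sval x) (sval y), x = y | on_rel (sval y) (sval x)].
Proof.
have [h|h|h] := on_total (sval x) (sval y).
- exact: Or31.
- by apply: Or32; case: x y h => x hx [y hy] /= e; exact: eq_exist.
- exact: Or33.
Qed.

Lemma segment_wf (a : ordinal_number) (z : a) :
  well_founded (fun x y : segment z => on_rel (sval x) (sval y)).
Proof. exact: (wf_inverse_image _ _ _ sval (@on_wf a)). Qed.

Definition initial_segment (a : ordinal_number) (z : a) : ordinal_number :=
  OrdinalNumber (@segment_trans a z) (@segment_total a z) (@segment_wf a z).

Definition on_lt (a b : ordinal_number) : Prop :=
  exists z : b, on_eq a (initial_segment z).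

(* Main.v *)
Require Import Defs.
From mathcomp Require Import all_boot.
From Stdlib Require Import Inverse_Image.

(** A grid from [(u, v)] to [(u1, v1)] witnesses [u v1 = v u1] in the monoid.
    Conversely, if [u v' = v u'] holds in the monoid, then some grid from
    [(u, v)] to some [(u1, v1)] and some word [x] satisfy [u' = u1 x] and
    [v' = v1 x]: grids are cofinal among common right multiples.  This is shown
    by induction on [lambda (u v')].  For [u] a letter [s], start from the
    evident grid from [(s, s v')] to [(epsilon, v')] and transform its top side
    relation by relation into [v u']: a relation applied at the beginning of the
    word is handled by (ii), and everything to the right of a nonempty prefix
    has a smaller [lambda].  With [u = v = s], condition (iii) forces [u1 = v1],
    hence [u' = v']. *)

Set Implicit Arguments.
Unset Strict Implicit.
Unset Printing Implicit Defensive.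

(** * Well-foundedness of the comparison of ordinals *)

(* Up to isomorphism this is [on_lt], but it composes without any transport
   between initial segments. *)
Definition bounded_embedding (a b : ordinal_number) : Prop :=
  exists (f : a -> b) (z : b),
    (forall x y, on_rel x y -> on_rel (f x) (f y)) /\
    forall x, on_rel (f x) z.

(** Induction on the bound [z] inside [b]: if [f] embeds [a] below [z] and [g] embeds [c] in [a]
    below [y], then [f \o g] embeds [c] below [f y], which is smaller than [z]. *)
Lemma bounded_embedding_wf : well_founded bounded_embedding.
Proof.
have below (b : ordinal_number) (z : b) : forall (a : ordinal_number)
    (f : a -> b), (forall x y, on_rel x y -> on_rel (f x) (f y)) ->
    (forall x, on_rel (f x) z) -> Acc bounded_embedding a.
  elim/(well_founded_ind (@on_wf b)): z => z IH a f fmono fz.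
  constructor=> c [g [y [gmono gy]]].
  apply: (IH (f y) (fz y) c (f \o g)) => [x x' h|x] /=.
    by apply: fmono; apply: gmono.
  exact: fmono.
move=> b; constructor=> a [f [z [fmono fz]]].
exact: (below b z a f).
Qed.

Lemma bounded_embedding_trans a b c :
  bounded_embedding a b -> bounded_embedding b c -> bounded_embedding a c.
Proof.
move=> [f [y [fmono _]]] [g [z [gmono gz]]]; exists (g \o f), z.
by split=> [x x' h|x] /=; [apply: gmono; apply: fmono|apply: gz].
Qed.

Lemma bounded_embedding_eq a b c :
  bounded_embedding a b -> on_eq b c -> bounded_embedding a c.
Proof.
move=> [f [z [fmono fz]]] [g [_ gmono]]; exists (g \o f), (g z).
by split=> [x y h|x] /=; apply/gmono; [apply: fmono|apply: fz].
Qed.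

Lemma on_lt_bounded_embedding a b : on_lt a b -> bounded_embedding a b.
Proof.
move=> [z [f [_ fmono]]]; exists (fun x => sval (f x)), z.
by split=> [x y /fmono //|x]; case: (f x).
Qed.

(** * Grids described by the words on their sides *)

Section WordGrids.
Variables (S : choiceType) (R : presentation S).
Implicit Types (u v w p q r b : seq S) (l t : seq (label S)).

(* Grids seen through the words on their sides: epsilon labels are dropped, so
   that two grids can be glued as soon as the words on their common side agree. *)
Inductive word_grid : seq S -> seq S -> seq S -> seq S -> Prop :=
| word_grid_relation s s' r b : is_relation R (s :: b) (s' :: r) ->
    word_grid [:: s] [:: s'] r b
| word_grid_same s : word_grid [:: s] [:: s] [::] [::]
| word_grid_left u : word_grid u [::] u [::]
| word_grid_top v : word_grid [::] v [::] v
| word_grid_beside u v v' m r b b' :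
    word_grid u v m b -> word_grid m v' r b' ->
    word_grid u (v ++ v') r (b ++ b')
| word_grid_above u u' v m r r' b :
    word_grid u v r m -> word_grid u' m r' b ->
    word_grid (u ++ u') v (r ++ r') b.

Lemma is_relation_sym w w' : is_relation R w w' -> is_relation R w' w.
Proof. by case; [right|left]. Qed.

(** The two boundary paths from the upper left to the lower right corner are congruent: in a glued
    grid, the path is pushed across one component at a time. *)
Lemma word_grid_sound u v r b :
  word_grid u v r b -> pres_congr R (u ++ b) (v ++ r).
Proof.
elim=> {u v r b} [s s' r b|s|u|v|u v v' m r b b' _ IH1 _ IH2
                 |u u' v m r r' b _ IH1 _ IH2]; rewrite ?cats0.
- exact: pres_congr_rel.
- exact: pres_congr_refl.
- exact: pres_congr_refl.
- exact: pres_congr_refl.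
- rewrite catA; apply: (@pres_congr_trans _ _ _ ((v ++ m) ++ b')).
    by apply: pres_congr_cat => //; apply: pres_congr_refl.
  rewrite -!catA; apply: pres_congr_cat => //; exact: pres_congr_refl.
- rewrite catA; apply: (@pres_congr_trans _ _ _ (u ++ (m ++ r'))).
    rewrite -!catA; apply: pres_congr_cat => //; exact: pres_congr_refl.
  by rewrite catA; apply: pres_congr_cat => //; apply: pres_congr_refl.
Qed.

Lemma cat_eq_nil (T : Type) (x y : seq T) : x ++ y = [::] -> x = [::] /\ y = [::].
Proof. by case: x; case: y. Qed.

(** This lets degenerate components be dropped, since gluing along words allows a component with an
    empty side. *)
Lemma word_grid_nil u v r b : word_grid u v r b ->
  (u = [::] -> r = [::] /\ b = v) /\ (v = [::] -> b = [::] /\ r = u).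
Proof.
elim=> {u v r b} [||||u v v' m r b b' _ [IHl IHt] _ [IHl' IHt']
                 |u u' v m r r' b _ [IHl IHt] _ [IHl' IHt']] //; split.
- by case/IHl => /IHl' [-> ->] ->.
- by case/cat_eq_nil => /IHt [-> em] /IHt' [-> ->].
- by case/cat_eq_nil => /IHl [-> em] /IHl' [-> ->].
- by case/IHt => /IHt' [-> ->] ->.
Qed.

Lemma cat_eq_cat (T : Type) (x y x' y' : seq T) : x ++ y = x' ++ y' ->
  (exists m, x = x' ++ m /\ y' = m ++ y) \/ (exists m, x' = x ++ m /\ y = m ++ y').
Proof.
elim: x x' => [|a x IH] [|a' x'] /=.
- by move=> ->; left; exists [::].
- by move=> ->; right; exists (a' :: x').
- by move=> <-; left; exists (a :: x).
- by case=> -> /IH[[m [-> ->]]|[m [-> ->]]]; [left|right]; exists m.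
Qed.

(** A vertical cut crosses only one of two grids placed side by side. For stacked grids, the cut of
    the upper one splits the common side and thus prescribes the cut of the lower one. *)
Lemma word_grid_split u v r b : word_grid u v r b ->
  forall p q, v = p ++ q -> exists m b1 b2,
    [/\ b = b1 ++ b2, word_grid u p m b1 & word_grid m q r b2].
Proof.
(* A cut at an end of the top side splits off a strip with empty top; a tile with a one-letter top
   admits no other cut. *)
have trivial_split u' v' r' b' p q : word_grid u' v' r' b' -> v' = p ++ q ->
    p = [::] \/ q = [::] -> exists m b1 b2,
    [/\ b' = b1 ++ b2, word_grid u' p m b1 & word_grid m q r' b2].
  move=> g e [ep|eq]; subst.
  - by exists u', [::], b'; split=> //; apply: word_grid_left.
  - rewrite cats0 in g; exists r', b', [::].
    by split; rewrite ?cats0 //; apply: word_grid_left.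
have short (s : S) p q : [:: s] = p ++ q -> p = [::] \/ q = [::].
  by case: p => [|a [|a' p]] //; [left|case: q => //; right].
elim=> {u v r b} [s s' r b h|s|u|v|u v v' m r b b' g1 IH1 g2 IH2
                 |u u' v m r r' b g1 IH1 g2 IH2] p q e.
- apply: (trivial_split _ _ _ _ _ _ _ e (short _ _ _ e)).
  exact: word_grid_relation.
- apply: (trivial_split _ _ _ _ _ _ _ e (short _ _ _ e)).
  exact: word_grid_same.
- apply: (trivial_split _ _ _ _ _ _ (word_grid_left u) e).
  by case/esym/cat_eq_nil: e; left.
- by exists [::], p, q; split=> //; apply: word_grid_top.
- case: (cat_eq_cat e) => [[x [ev eq]]|[x [ep ev']]].
  + have [n [b1 [b2 [-> h1 h2]]]] := IH1 _ _ ev.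
    exists n, b1, (b2 ++ b'); split; rewrite ?catA // eq.
    exact: word_grid_beside h2 g2.
  + have [n [b1 [b2 [-> h1 h2]]]] := IH2 _ _ ev'.
    exists n, (b ++ b1), b2; split; rewrite ?catA // ep.
    exact: word_grid_beside g1 h1.
- have [n [b1 [b2 [em h1 h2]]]] := IH1 _ _ e.
  have [n' [c1 [c2 [eb h1' h2']]]] := IH2 _ _ em.
  exists (n ++ n'), c1, c2; split=> //.
  + exact: word_grid_above h1 h1'.
  + exact: word_grid_above h2 h2'.
Qed.

(** * Passage between diagrams with epsilon labels and word grids *)

Lemma label_word_cat l l' : label_word (l ++ l') = label_word l ++ label_word l'.
Proof. exact: pmap_cat. Qed.

Lemma label_word_piece_side w : label_word (piece_side w) = w.
Proof.
have e x : label_word (map some x) = x by elim: x => //= a x ->.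
by case: w => // a w; apply: e.
Qed.

Lemma piece_side_neq_nil w : piece_side w <> [::].
Proof. by case: w. Qed.

Lemma diagram_word_grid l t (r b : seq (label S)) : diagram R l t r b ->
  word_grid (label_word l) (label_word t) (label_word r) (label_word b).
Proof.
elim=> {l t r b} [l t r b|l t t' m r b b' _ IH1 _ IH2
                 |l l' t m r r' b _ IH1 _ IH2]; rewrite ?label_word_cat.
- case=> [s s' ss ts h|s|s|s|] /=; rewrite ?label_word_piece_side.
  + exact: word_grid_relation.
  + exact: word_grid_same.
  + exact: (word_grid_left [:: s]).
  + exact: (word_grid_top [:: s]).
  + exact: word_grid_left.
- exact: word_grid_beside IH1 IH2.
- exact: word_grid_above IH1 IH2.
Qed.

Lemma diagram_none_row t : t <> [::] -> inhabited (diagram R [:: None] t [:: None] t).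
Proof.
elim: t => // x t IH _.
have D : diagram R [:: None] [:: x] [:: None] [:: x].
  by apply: diagram_piece; case: x => [s|]; constructor.
case: t IH => [|y t] IH; first by exists.
case: IH => // D'; exists; exact: (diagram_beside D D').
Qed.

Lemma diagram_none_column l : l <> [::] -> inhabited (diagram R l [:: None] l [:: None]).
Proof.
elim: l => // x l IH _.
have D : diagram R [:: x] [:: None] [:: x] [:: None].
  by apply: diagram_piece; case: x => [s|]; constructor.
case: l IH => [|y l] IH; first by exists.
case: IH => // D'; exists; exact: (diagram_above D D').
Qed.

(* [realizes l t r b]: epsilon labels can be distributed at will on the left and
   top sides, at the price of some on the right and bottom sides. *)
Definition realizes l t r b : Prop := exists r' b' : seq (label S),
  [/\ label_word r' = r, label_word b' = b & inhabited (diagram R l t r' b')].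

Lemma diagram_neq_nil l t (r b : seq (label S)) : diagram R l t r b ->
  [/\ l <> [::], t <> [::], r <> [::] & b <> [::]].
Proof.
elim=> {l t r b} [l t r b|l t t' m r b b' _ [? ? ? ?] _ [? ? ? ?]
                 |l l' t m r r' b _ [? ? ? ?] _ [? ? ? ?]].
- by case=> *; split=> //; apply: piece_side_neq_nil.
- by split=> // /cat_eq_nil[].
- by split=> // /cat_eq_nil[].
Qed.

Lemma realizes_none_above l t r b :
  realizes l t r b -> realizes (None :: l) t r b.
Proof.
move=> [r' [b' [<- <- [D]]]]; have [_ tn _ _] := diagram_neq_nil D.
have [D'] := diagram_none_row tn.
by exists (None :: r'), b'; split=> //; exists; apply: (diagram_above D' D).
Qed.

Lemma realizes_none_beside l t r b :
  realizes l t r b -> realizes l (None :: t) r b.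
Proof.
move=> [r' [b' [<- <- [D]]]]; have [ln _ _ _] := diagram_neq_nil D.
have [D'] := diagram_none_column ln.
by exists r', (None :: b'); split=> //; exists; apply: (diagram_beside D' D).
Qed.

Lemma realizes_nones_below l l' t r b : label_word l' = [::] ->
  realizes l t r b -> realizes (l ++ l') t r b.
Proof.
elim: l' l => [|[s|] l' IH] l //=; first by rewrite cats0.
move=> e [r' [b' [er eb [D]]]].
rewrite -cat_rcons; apply: IH => //.
have [_ _ _ bn] := diagram_neq_nil D; have [D'] := diagram_none_row bn.
exists (r' ++ [:: None]), b'; rewrite label_word_cat cats0 -cats1.
by split=> //; exists; apply: (diagram_above D D').
Qed.

Lemma realizes_nones_right l t t' r b : label_word t' = [::] ->
  realizes l t r b -> realizes l (t ++ t') r b.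
Proof.
elim: t' t => [|[s|] t' IH] t //=; first by rewrite cats0.
move=> e [r' [b' [er eb [D]]]].
rewrite -cat_rcons; apply: IH => //.
have [_ _ rn _] := diagram_neq_nil D; have [D'] := diagram_none_column rn.
exists r', (b' ++ [:: None]); rewrite label_word_cat cats0 -cats1.
by split=> //; exists; apply: (diagram_beside D D').
Qed.

(** A side spelling a single letter is that letter surrounded by epsilons, which are absorbed by
    trivial rows and columns. *)
Lemma realizes_letters s s' l t r b :
  realizes [:: Some s] [:: Some s'] r b ->
  label_word l = [:: s] -> label_word t = [:: s'] -> realizes l t r b.
Proof.
move=> h el et.
have {h el} : realizes l [:: Some s'] r b.
  elim: l el => // [[a|] l IH] /=; last by move/IH; apply: realizes_none_above.
  by case=> -> e; apply: (realizes_nones_below (l := [:: Some s])).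
elim: t et => // [[a|] t IH] /=; last by move=> /IH h /h; apply: realizes_none_beside.
by case=> -> e; apply: (realizes_nones_right (t := [:: Some s'])).
Qed.

Lemma realizes_left l t :
  l <> [::] -> t <> [::] -> label_word t = [::] -> realizes l t (label_word l) [::].
Proof.
move=> ln; case: t => // [[s|] t] //= _ e.
apply: (realizes_nones_right (t := [:: None])) => //.
by exists l, [:: None]; split=> //; apply: diagram_none_column.
Qed.

Lemma realizes_top l t :
  l <> [::] -> t <> [::] -> label_word l = [::] -> realizes l t [::] (label_word t).
Proof.
move=> ln tn; case: l ln => // [[s|] l] //= _ e.
apply: (realizes_nones_below (l := [:: None])) => //.
by exists [:: None], t; split=> //; apply: diagram_none_row.
Qed.

Lemma label_word_eq_cat l v v' : label_word l = v ++ v' ->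
  exists l1 l2, [/\ l = l1 ++ l2, label_word l1 = v & label_word l2 = v'].
Proof.
elim: l v => [|[s|] l IH] v /=.
- by move/esym/cat_eq_nil=> [-> ->]; exists [::], [::].
- case: v => [|a v] /=.
    by move=> <-; exists [::], (Some s :: l).
  by case=> <- /IH [l1 [l2 [-> <- <-]]]; exists (Some s :: l1), l2.
- by case/IH=> l1 [l2 [-> <- <-]]; exists (None :: l1), l2.
Qed.

(** Quantifying over all labelings of the left and top sides makes gluing possible: the second
    diagram is built on whatever labels the first one leaves on the common side. *)
Lemma word_grid_realizes u v r b : word_grid u v r b ->
  forall l t, l <> [::] -> t <> [::] -> label_word l = u -> label_word t = v ->
  realizes l t r b.
Proof.
elim=> {u v r b} [s s' r b h|s|u|v|u v v' m r b b' g1 IH1 g2 IH2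
                 |u u' v m r r' b g1 IH1 g2 IH2] l t ln tn el et.
- apply: realizes_letters el et; exists (piece_side r), (piece_side b).
  rewrite !label_word_piece_side; split=> //; exists.
  by apply: diagram_piece; apply: piece_relation.
- apply: realizes_letters el et; exists [:: None], [:: None].
  by split=> //; exists; apply: diagram_piece; apply: piece_same.
- by rewrite -el; apply: realizes_left.
- by rewrite -et; apply: realizes_top.
- have [t1 [t2 [e e1 e2]]] := label_word_eq_cat et; subst t.
  (* No diagram has a side without edges. If one part of the top labels is empty, its component is
     trivial and the other one suffices. *)
  case: t1 => [|x t1] in tn et e1 *.
    have [-> em] := (word_grid_nil g1).2 (esym e1).
    by apply: IH2 => //; rewrite em.
  case: t2 => [|y t2] in tn et e2 *.
    have [-> ->] := (word_grid_nil g2).2 (esym e2).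
    by rewrite !cats0; apply: IH1.
  have [m' [b1 [em <- [D1]]]] := IH1 l (x :: t1) ln (fun e => ltac:(done)) el e1.
  have [_ _ mn _] := diagram_neq_nil D1.
  have [r' [b2 [<- <- [D2]]]] := IH2 m' (y :: t2) mn (fun e => ltac:(done)) em e2.
  exists r', (b1 ++ b2); rewrite label_word_cat; split=> //; exists.
  exact: diagram_beside D1 D2.
- have [l1 [l2 [e e1 e2]]] := label_word_eq_cat el; subst l.
  case: l1 => [|x l1] in ln el e1 *.
    have [-> em] := (word_grid_nil g1).1 (esym e1).
    by apply: IH2 => //; rewrite em.
  case: l2 => [|y l2] in ln el e2 *.
    have [-> ->] := (word_grid_nil g2).1 (esym e2).
    by rewrite !cats0; apply: IH1.
  have [r1 [m' [<- em [D1]]]] := IH1 (x :: l1) t (fun e => ltac:(done)) tn e1 et.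
  have [_ _ _ mn] := diagram_neq_nil D1.
  have [r2 [b' [<- <- [D2]]]] := IH2 (y :: l2) m' (fun e => ltac:(done)) mn e2 em.
  exists (r1 ++ r2), b'; rewrite label_word_cat; split=> //; exists.
  exact: diagram_above D1 D2.
Qed.

Lemma word_gridP u v r b : word_grid u v r b <->
  exists G : grid R, [/\ grid_from G u v, right_word G = r & bottom_word G = b].
Proof.
split=> [g|[[l t r' b' D] [[<- <-] <- <-]]]; last exact: diagram_word_grid.
have [r' [b' [er eb [D]]]] := word_grid_realizes g (@piece_side_neq_nil u)
  (@piece_side_neq_nil v) (label_word_piece_side u) (label_word_piece_side v).
by exists (Grid D); split=> //; split; apply: label_word_piece_side.
Qed.

(** * Grids from a letter to itself *)

(** When two grids are glued, the letter lies in only one of them and the other is trivial. This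
    reduces the claim to a single tile, where [rel_inj] settles the relation case. *)
Lemma word_grid_same_letter s u v r b :
  (forall w w', is_relation R (s :: w) (s :: w') -> w = w') ->
  word_grid u v r b -> u = [:: s] -> v = [:: s] -> r = b.
Proof.
move=> rel_inj; have letter (x y : seq S) : x ++ y = [:: s] ->
    x = [::] /\ y = [:: s] \/ x = [:: s] /\ y = [::].
  by case: x => [|a [|a' x]] /=; [left|case: y => //; right|].
elim=> {u v r b} [t t' r b h|t|u|v|u v v' m r b b' g1 IH1 g2 IH2
                 |u u' v m r r' b g1 IH1 g2 IH2] //.
- by case=> et [et']; subst; rewrite (rel_inj _ _ h).
- move=> eu /letter[[ev ev']|[ev ev']].
    have [-> em] := (word_grid_nil g1).2 ev.
    by apply: IH2 => //; rewrite em.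
  by have [-> ->] := (word_grid_nil g2).2 ev'; rewrite cats0; apply: IH1.
- move=> /letter[[eu eu']|[eu eu']] ev.
    have [-> em] := (word_grid_nil g1).1 eu.
    by apply: IH2 => //; rewrite em.
  by have [-> ->] := (word_grid_nil g2).1 eu'; rewrite cats0; apply: IH1.
Qed.

(** * Cofinality of grids among common right multiples *)

Definition factors_through_grid u v u' v' : Prop := exists u1 v1 x,
  [/\ word_grid u v u1 v1, pres_congr R u' (u1 ++ x) & pres_congr R v' (v1 ++ x)].

Lemma pres_congr_catl u v v' : pres_congr R v v' -> pres_congr R (u ++ v) (u ++ v').
Proof. by apply: pres_congr_cat; apply: pres_congr_refl. Qed.

Lemma pres_congr_catr u u' v : pres_congr R u u' -> pres_congr R (u ++ v) (u' ++ v).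
Proof. by move=> h; apply: pres_congr_cat => //; apply: pres_congr_refl. Qed.

Section Completeness.
Variable lt : seq S -> seq S -> Prop.
Hypothesis lt_wf : well_founded lt.
Hypothesis lt_trans : forall u v w, lt u v -> lt v w -> lt u w.
Hypothesis lt_congr : forall u v w, lt u v -> pres_congr R v w -> lt u w.
Hypothesis lt_cons : forall s w, lt w (s :: w).
Hypothesis grid_exchange : forall s w w' r b, is_relation R w w' ->
  word_grid [:: s] w r b -> exists r' b',
    [/\ word_grid [:: s] w' r' b', pres_congr R r r' & pres_congr R b b'].

Lemma lt_cat s w q : lt q ((s :: w) ++ q).
Proof.
elim: w s => [|a w IH] s; first exact: lt_cons.
exact: lt_trans (IH a) (lt_cons s _).
Qed.

(** The empty word is [lt]-below every nonempty word, so a congruence between them would give [lt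
    [::] [::]], against well-foundedness. *)
Lemma pres_congr_nil w : pres_congr R [::] w -> w = [::].
Proof.
case: w => // s w h; have irr x : ~ lt x x.
  by elim/(well_founded_ind lt_wf): x => x IH l; exact: (IH x).
case: (irr [::]); apply: (lt_congr (v := s :: w)); last exact: pres_congr_sym.
by have := lt_cat s w [::]; rewrite cats0.
Qed.

(** The common multiple is fixed only up to congruence, so that [lt] can serve as the induction
    order on it. *)
Definition complete_at x : Prop := forall u v u' v',
  pres_congr R (u ++ v') x -> pres_congr R (v ++ u') x ->
  factors_through_grid u v u' v'.

(** This is the case where [v] is itself the common multiple: the cofactor of [v] is empty, hence so
    are the right side and the remaining factor. *)
Lemma complete_at_full x u v b : complete_at x -> pres_congr R (u ++ b) x ->
  pres_congr R v x -> exists b', word_grid u v [::] b' /\ pres_congr R b b'.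
Proof.
move=> cx eu ev; have [||u1 [v1 [y [g h1 h2]]]] := cx u v [::] b.
- exact: eu.
- by rewrite cats0.
have [eu1 ey] := cat_eq_nil (pres_congr_nil h1); subst.
by exists v1; rewrite cats0 in h2.
Qed.

Lemma full_grid_rewrite x s p w w' q b :
  (forall y, lt y x -> complete_at y) -> is_relation R w w' ->
  pres_congr R (p ++ w ++ q) x -> word_grid [:: s] (p ++ w ++ q) [::] b ->
  exists b', word_grid [:: s] (p ++ w' ++ q) [::] b' /\ pres_congr R b b'.
Proof.
move=> IH h ex g.
(* Behind a nonempty prefix, [w ++ q] is smaller than [x], so that part of the grid is replaced at
   once by the induction hypothesis. *)
case: p => [|a p] in ex g *; last first.
  have [u1 [b1 [b2 [-> g1 g2]]]] := word_grid_split g (erefl ((a :: p) ++ w ++ q)).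
  have [|||b' [g' e']] := @complete_at_full (w ++ q) u1 (w' ++ q) b2.
  - by apply: IH; apply: lt_congr ex; apply: lt_cat.
  - by have := word_grid_sound g2; rewrite cats0.
  - by apply: pres_congr_catr; apply: pres_congr_sym; apply: pres_congr_rel.
  exists (b1 ++ b'); split; last exact: pres_congr_catl.
  exact: word_grid_beside g1 g'.
case: w => [|a w] in h ex g *.
  rewrite (pres_congr_nil (pres_congr_rel h)); exists b; split=> //.
  exact: pres_congr_refl.
have [u1 [b1 [b2 [-> g1 g2]]]] := word_grid_split g (erefl ((a :: w) ++ q)).
(* The new right side [u2] is only congruent to [u1], so the grid over [q] must be rebuilt; [q] is
   smaller than [x] because the relation side before it is nonempty. *)
have [u2 [b1' [g1' e1 e2]]] := grid_exchange h g1.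
have [|||b2' [g2' e3]] := @complete_at_full q u2 q b2; last 1 first.
- exists (b1' ++ b2'); split; last exact: pres_congr_cat.
  exact: word_grid_beside g1' g2'.
- by apply: IH; apply: lt_congr ex; apply: lt_cat.
- apply: pres_congr_trans (pres_congr_catr _ (pres_congr_sym e1)) _.
  by have := word_grid_sound g2; rewrite cats0.
- exact: pres_congr_refl.
Qed.

(** The equivalence absorbs the symmetry rule of the congruence, and the contexts [p] and [q] absorb
    its concatenation rule by rewriting one factor after the other. *)
Lemma full_grid_congr x s b z z' :
  (forall y, lt y x -> complete_at y) -> pres_congr R z z' ->
  let full y := exists b', word_grid [:: s] y [::] b' /\ pres_congr R b b' in
  forall p q, pres_congr R (p ++ z ++ q) x -> full (p ++ z ++ q) <-> full (p ++ z' ++ q).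
Proof.
move=> IH + full; have shift (p w w' q : seq S) :
    pres_congr R w w' -> pres_congr R (p ++ w ++ q) x ->
    pres_congr R (p ++ w' ++ q) x.
  move=> h; apply: pres_congr_trans; apply: pres_congr_catl.
  by apply: pres_congr_catr; apply: pres_congr_sym.
have one (w w' p q : seq S) : is_relation R w w' ->
    pres_congr R (p ++ w ++ q) x -> full (p ++ w ++ q) -> full (p ++ w' ++ q).
  move=> h ex [b1 [g e]]; have [b2 [g' e']] := full_grid_rewrite IH h ex g.
  by exists b2; split=> //; apply: pres_congr_trans e e'.
elim=> {z z'} [w w' h|w|w w' h IHw|w1 w2 w3 h1 IH1 h2 IH2|u u' v v' h1 IH1 h2 IH2] p q ex.
- split; first exact: one.
  by apply: one; [apply: is_relation_sym|apply: shift ex; apply: pres_congr_rel].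
- by [].
- by apply: iff_sym; apply: IHw; apply: shift ex; apply: pres_congr_sym.
- by apply: iff_trans (IH1 _ _ ex) (IH2 _ _ (shift _ _ _ _ h1 ex)).
- rewrite -!catA in ex *.
  apply: iff_trans (IH1 p (v ++ q) ex) _; rewrite !(catA p u').
  by apply: IH2; rewrite -catA; apply: shift ex.
Qed.

Lemma grid_complete x : complete_at x.
Proof.
elim/(well_founded_ind lt_wf): x => x IH u v u' v' eu ev.
case: u => [|s u] in eu *.
  exists [::], v, u'; split; [exact: word_grid_top|exact: pres_congr_refl|].
  exact: pres_congr_trans eu (pres_congr_sym ev).
have evu : pres_congr R (s :: u ++ v') (v ++ u').
  exact: pres_congr_trans eu (pres_congr_sym ev).
have := full_grid_congr s (u ++ v') IH evu (p := [::]) (q := [::]).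
rewrite /= !cats0 => /(_ eu) [+ _]; case.
  exists (u ++ v'); split; last exact: pres_congr_refl.
  exact: word_grid_beside (word_grid_same s) (word_grid_top _).
move=> b [g e].
have [u1 [v1 [b2 [eb g1 g2]]]] := word_grid_split g (erefl (v ++ u')); subst b.
(* Below the row of [s], the bottom word gives the smaller common multiple [u ++ v'] of [u] and
   [v1], with [b2] in the role of [u']. The grid obtained by induction is stacked under [g1]. *)
have ltx : lt (u ++ v') x by apply: lt_congr eu; apply: lt_cons.
have [||u2 [v2 [y [g3 e1 e2]]]] := IH _ ltx u v1 b2 v'.
- exact: pres_congr_refl.
- exact: pres_congr_sym.
exists (u1 ++ u2), v2, y; split=> //.
- exact: (word_grid_above g1 g3).
- rewrite -catA; apply: pres_congr_trans (pres_congr_catl _ e1).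
  by have := word_grid_sound g2; rewrite cats0 => /pres_congr_sym.
Qed.

End Completeness.

End WordGrids.

Theorem proposition1p17 (S : choiceType) (R : presentation S)
  (S_nonempty : inhabited S)
  (hi : exists lambda : seq S -> ordinal_number,
      (forall w w' : seq S, pres_congr R w w' -> on_eq (lambda w) (lambda w')) /\
      (forall (s : S) (w : seq S), on_lt (lambda w) (lambda (s :: w))))
  (hii : forall (s : S) (w w' : seq S), is_relation R w w' ->
      (forall G : grid R, grid_from G [:: s] w ->
         exists G' : grid R, grid_from G' [:: s] w' /\ grid_equiv G G') /\
      (forall G : grid R, grid_from G [:: s] w' ->
         exists G' : grid R, grid_from G' [:: s] w /\ grid_equiv G G'))
  (hiii : ~ exists (s : S) (w w' : seq S),
      w <> w' /\ is_relation R (s :: w) (s :: w')) :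
  left_cancellative (presented_monoid R).
Proof.
have [lambda [lambda_congr lambda_cons]] := hi.
pose lt (u v : seq S) := bounded_embedding (lambda u) (lambda v).
have lt_wf : well_founded lt by apply: wf_inverse_image; apply: bounded_embedding_wf.
have lt_trans u v w : lt u v -> lt v w -> lt u w.
  exact: bounded_embedding_trans.
have lt_congr u v w : lt u v -> pres_congr R v w -> lt u w.
  by move=> h /lambda_congr; apply: bounded_embedding_eq.
have lt_cons s w : lt w (s :: w) by apply: on_lt_bounded_embedding.
have exchange s w w' r b : is_relation R w w' -> word_grid R [:: s] w r b ->
    exists r' b', [/\ word_grid R [:: s] w' r' b',
      pres_congr R r r' & pres_congr R b b'].
  move=> h /word_gridP [G [from_w <- <-]].
  have [G' [from_w' [_ _ er eb]]] := (hii s w w' h).1 G from_w.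
  by exists (right_word G'), (bottom_word G'); split=> //; apply/word_gridP; exists G'.
have rel_inj s w w' : is_relation R (s :: w) (s :: w') -> w = w'.
  by move=> h; have [//|/eqP ne] := eqVneq w w'; case: hiii; exists s, w, w'.
have cancel (u v v' : seq S) : pres_congr R (u ++ v) (u ++ v') -> pres_congr R v v'.
  (* Letters of [u] are cancelled one at a time. The grid from [s] and [s] has equal right and
     bottom words, so both remainders are congruent to the same word. *)
  elim: u => //= s u IH h; apply: IH.
  have [u1 [v1 [x [g e e']]]] :=
    grid_complete lt_wf lt_trans lt_congr lt_cons exchange (u := [:: s])
      (v := [:: s]) (v' := u ++ v) (u' := u ++ v') h (pres_congr_refl R _).
  move: e e'; rewrite (word_grid_same_letter (rel_inj s) g) // => e e'.
  exact: pres_congr_trans e' (pres_congr_sym e).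
have word (x : presented_monoid R) : exists w, x = word_class R w.
  by exists (generic_quotient.repr x); rewrite /word_class generic_quotient.reprK.
move=> x y z; have [[u ->] [v ->]] := (word x, word y); have [w ->] := word z.
change (pm_mul (word_class R u) (word_class R v) =
  pm_mul (word_class R u) (word_class R w) -> word_class R v = word_class R w).
by rewrite !pm_mulE => /word_classP h; apply/word_classP; apply: cancel h.
Qed.
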